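(* Let $(X,\mathcal{A},\mu)$ be a measure space and let $I$ be an ideal of the ring $\mathcal{M}(X,\mathcal{A})$. If $f\in L_I^\infty(\mu)$, then the map $\phi_f:\mathbb{R}\to\mathcal{M}(X,\mathcal{A})$ given by $\phi_f(r)=rf$ is continuous when $\mathbb{R}$ has its usual topology and $\mathcal{M}(X,\mathcal{A})$ is equipped with the $U_{\mu_I}$-topology.
   Context: $X$ is a non-empty set, $\mathcal{A}$ a $\sigma$-algebra on $X$, and $\mu:\mathcal{A}\to[0,\infty]$ a measure. $\mathcal{M}(X,\mathcal{A})$ is the commutative ring with unity of all real-valued $\mathcal{A}$-measurable functions on $X$, with pointwise operations. For $g\in\mathcal{M}(X,\mathcal{A})$, $Z(g)=\{x\in X: g(x)=0\}$, and for an ideal $I$, $Z[I]=\{Z(g): g\in I\}$. Null sets $E$ below are always members of $\mathcal{A}$. $L_I^\infty(\mu)$ is the set of all $f\in\mathcal{M}(X,\mathcal{A})$ for which there exist $Z\in Z[I]$ and $E\subseteq Z$ with $\mu(E)=0$ such that $f$ is bounded on $Z\setminus E$. For $f\in\mathcal{M}(X,\mathcal{A})$ and real $\epsilon>0$, $U_{\mu_I}(f,\epsilon)$ is the set of all $g\in\mathcal{M}(X,\mathcal{A})$ such that $\sup_{x\in Z\setminus E}|f(x)-g(x)|<\epsilon$ for some $Z\in Z[I]$ and some $E\subseteq Z$ with $\mu(E)=0$ (the supremum is taken in $[0,\infty]$). The sets $U_{\mu_I}(f,\epsilon)$ form an open base for a topology on $\mathcal{M}(X,\mathcal{A})$, called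 the $U_{\mu_I}$-topology. *)

(* Defs.v *)
From HB Require Import structures.
From mathcomp Require Import all_boot all_order all_algebra.
From mathcomp Require Import all_classical all_reals all_analysis.
From mathcomp Require Import measurable_realfun.
From mathcomp Require Import lra.
Set Implicit Arguments.
Unset Strict Implicit.
Unset Printing Implicit Defensive.
Import Order.TTheory GRing.Theory Num.Theory.
Import numFieldNormedType.Exports.
Local Open Scope classical_set_scope.
Local Open Scope ring_scope.

(* The [idealr] structure of MathComp only covers proper ideals; here the whole
   ring counts as an ideal. *)
Record ring_ideal (A : comNzRingType) := RingIdeal {
  ideal_set : set A ;
  ideal0 : ideal_set 0 ;
  idealD : forall a b, ideal_set a -> ideal_set b -> ideal_set (a + b) ;
  idealM : forall a b, ideal_set b -> ideal_set (a * b) }.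

(* M(X, A) with the U_{mu_I}-topology. The parameters mu and I do not occur in
   the body: they only select the topology attached to this copy of the type. *)
Definition U_space d (X : measurableType d) (R : realType)
  (mu : {measure set X -> \bar R}) (I : ring_ideal {mfun X >-> R}) : Type :=
  {mfun X >-> R}.

Section u_mu_I.
Context d (X : measurableType d) (R : realType).
Variables (mu : {measure set X -> \bar R}) (I : ring_ideal {mfun X >-> R}).
Implicit Types (f g h : {mfun X >-> R}) (e : R) (A : set X).

Definition zero_set g : set X := [set x | g x = 0].

Definition zero_sets : set (set X) := [set zero_set g | g in ideal_set I].

(* The sets Z \ E with Z in Z[I] and E a null subset of Z. *)
Definition zero_mod_null : set (set X) :=
  [set A | exists Z E, [/\ zero_sets Z, E `<=` Z, measurable E,
                           mu E = 0%E & A = Z `\` E]].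

Definition Linfty : set {mfun X >-> R} :=
  [set f | exists2 A, zero_mod_null A & [bounded f x | x in A]].

(* The supremum is taken in [0, +oo]: adjoining 0 gives it the value 0 on the
   empty set, where [ereal_sup] alone would be -oo, and changes nothing else. *)
Definition sup_dist A f g : \bar R :=
  ereal_sup (0%E |` [set `|f x - g x|%:E | x in A]).

Definition U_ball f e : set {mfun X >-> R} :=
  [set g | exists2 A, zero_mod_null A & (sup_dist A f g < e%:E)%E].

Lemma sup_dist_ge0 A f g : (0 <= sup_dist A f g)%E.
Proof. by apply: ereal_sup_ubound; left. Qed.

Lemma sup_dist_ub A f g x : A x -> (`|f x - g x|%:E <= sup_dist A f g)%E.
Proof. by move=> Ax; apply: ereal_sup_ubound; right; exists x. Qed.

Lemma sup_dist_le A f g e : 0 <= e -> (forall x, A x -> `|f x - g x| <= e) ->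
  (sup_dist A f g <= e%:E)%E.
Proof.
move=> e0 H; apply: ge_ereal_sup => y [->|[x Ax <-]]; rewrite lee_fin; last exact: H.
by [].
Qed.

Lemma U_ballP f g e : U_ball f e g <->
  exists A c, [/\ zero_mod_null A, 0 <= c, c < e
                & forall x, A x -> `|f x - g x| <= c].
Proof.
split=> [[A zA]|[A [c [zA c0 ce H]]]]; last first.
  exists A => //; apply: le_lt_trans (sup_dist_le c0 H) _.
  by rewrite lte_fin.
have := sup_dist_ge0 A f g; have := @sup_dist_ub A f g.
case: (sup_dist A f g) => [c H|H|H] //.
rewrite lee_fin lte_fin => c0 ce; by exists A, c; split.
Qed.

Lemma zero_mod_nullT0 : exists A, zero_mod_null A.
Proof.
exists setT, setT, set0; split => //; last by rewrite setD0.
exists 0; first exact: ideal0.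
by apply/seteqP; split=> // x _.
Qed.

Lemma zero_mod_nullI A B : zero_mod_null A -> zero_mod_null B ->
  zero_mod_null (A `&` B).
Proof.
move=> [_ [E [[g Ig <-] EZ mE E0 ->]]] [_ [F [[h Ih <-] FZ mF F0 ->]]].
have IZ : ideal_set I (g * g + h * h).
  by apply: idealD; exact: idealM.
have mZ k : measurable (zero_set k).
  have -> : zero_set k = k @^-1` [set 0] by [].
  by rewrite -[X in measurable X]setTI; exact: measurable_funPT.
have ZE : zero_set (g * g + h * h) = zero_set g `&` zero_set h.
  apply/seteqP; split=> x; rewrite /zero_set /=.
    rewrite -!expr2 => /eqP; rewrite paddr_eq0 ?sqr_ge0// !sqrf_eq0.
    by case/andP => /eqP ? /eqP.
  by case=> gx hx; rewrite -[LHS]/(g x * g x + h x * h x) gx hx mulr0 addr0.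
exists (zero_set g `&` zero_set h), ((zero_set g `&` zero_set h) `&` (E `|` F)).
have mEF : measurable ((zero_set g `&` zero_set h) `&` (E `|` F)).
  by apply: measurableI; [exact: measurableI|exact: measurableU].
split => //.
- by exists (g * g + h * h).
- apply/eqP; rewrite eq_le measure_ge0 andbT.
  have /= <- : (mu E + mu F = 0)%E by rewrite E0 F0 adde0.
  apply: le_trans (measureU2 mu mE mF).
  by apply: le_measure; rewrite ?inE//; exact: measurableU.
- by apply/seteqP; split=> x /=; tauto.
Qed.

Lemma U_ball_center f e : 0 < e -> U_ball f e f.
Proof.
move=> e0; apply/U_ballP; have [A zA] := zero_mod_nullT0.
by exists A, 0; split => // x _; rewrite subrr normr0.
Qed.

Lemma U_ball_sub f g e : U_ball f e g ->
  exists2 e', 0 < e' & U_ball g e' `<=` U_ball f e.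
Proof.
move=> /U_ballP[A [c [zA c0 ce H]]]; exists (e - c); first by rewrite subr_gt0.
move=> h /U_ballP[B [c' [zB c'0 ce' H']]]; apply/U_ballP.
exists (A `&` B), (c + c'); split.
- exact: zero_mod_nullI.
- exact: addr_ge0.
- lra.
- move=> x [Ax Bx]; rewrite -(subrKA (g x)).
  by apply: le_trans (ler_normD _ _) _; apply: lerD; [exact: H|exact: H'].
Qed.

Lemma U_ballS f e e' : e <= e' -> U_ball f e `<=` U_ball f e'.
Proof.
by move=> ee' g [A zA l]; exists A => //; apply: lt_le_trans l _; rewrite lee_fin.
Qed.

HB.instance Definition _ := Choice.on (U_space mu I).
HB.instance Definition _ := isPointed.Build (U_space mu I) (0 : {mfun X >-> R}).

Let centers_radii : set (U_space mu I * R) := [set p | 0 < p.2].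
Let base (p : U_space mu I * R) : set (U_space mu I) := U_ball p.1 p.2.

Let base_cover : \bigcup_(p in centers_radii) base p = setT.
Proof.
apply/seteqP; split=> // f _; exists (f, 1); first exact: ltr01.
exact: U_ball_center.
Qed.

Let base_join p q f : centers_radii p -> centers_radii q ->
  base p f -> base q f ->
  exists r, [/\ centers_radii r, base r f & base r `<=` base p `&` base q].
Proof.
move=> _ _ /U_ball_sub[e1 e10 s1] /U_ball_sub[e2 e20 s2].
have e0 : 0 < Num.min e1 e2 by rewrite lt_min e10.
exists (f, Num.min e1 e2); split => //; first exact: U_ball_center.
move=> g H; split; [apply: s1|apply: s2]; apply: U_ballS H.
- by rewrite ge_min lexx.
- by rewrite ge_min lexx orbT.
Qed.

HB.instance Definition _ :=
  isBaseTopological.Build (U_space mu I) base_cover base_join.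

Lemma open_U_ball f e : 0 < e -> open (U_ball f e : set (U_space mu I)).
Proof.
move=> e0; exists [set ((f : U_space mu I), e)]; first by move=> _ ->.
by rewrite bigcup_set1.
Qed.

Lemma nbhs_U_ballP (f : U_space mu I) (V : set (U_space mu I)) :
  nbhs f V <-> exists2 e, 0 < e & U_ball f e `<=` V.
Proof.
rewrite nbhsE; split=> [[W [[D _ <-] [[g e] Dge Uge]] WV]|[e e0 UV]].
  have [e' e'0 sub] := U_ball_sub Uge; exists e' => // h /sub Uh.
  by apply: WV; exists (g, e).
by exists (U_ball f e) => //; split; [exact: open_U_ball|exact: U_ball_center].
Qed.

End u_mu_I.

(* Main.v *)
Require Import Defs.
From HB Require Import structures.
From mathcomp Require Import all_boot all_order all_algebra.
From mathcomp Require Import all_classical all_reals all_analysis.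
From mathcomp Require Import measurable_realfun.
Set Implicit Arguments.
Unset Strict Implicit.
Unset Printing Implicit Defensive.
Import Order.TTheory GRing.Theory Num.Theory.
Import numFieldNormedType.Exports.
Local Open Scope classical_set_scope.
Local Open Scope ring_scope.

(** Scaling f by r and by s moves it by |r - s| |f| pointwise. On the set Z \ E
    where f is bounded, say by M > 0, this is at most |r - s| M uniformly. Since
    that set does not depend on r or s, it witnesses closeness in the
    U_{mu_I}-sense for all scalars at once, so r |-> r f behaves like an
    M-Lipschitz map: s f lies in the ball of radius e about r f as soon as
    |r - s| < e / M ([U_ball_scale]). These balls are a neighbourhood base at
    r f, which gives continuity. *)

Lemma Linfty_bound (R : realType) (d : measure_display)
    (X : measurableType d) (mu : {measure set X -> \bar R})
    (I : ring_ideal {mfun X >-> R}) (f : {mfun X >-> R}) :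
  Linfty mu I f ->
  exists A M, [/\ zero_mod_null mu I A, 0 < M & forall x, A x -> `|f x| <= M].
Proof.
by case=> A zA /pinfty_ex_gt0[M M0 fM]; exists A, M; split.
Qed.

(** The bound on |r - s| is kept strict because [U_ball] asks for a supremum
    strictly below e, and |r - s| M is then an admissible bound for it. *)
Lemma U_ball_scale (R : realType) (d : measure_display)
    (X : measurableType d) (mu : {measure set X -> \bar R})
    (I : ring_ideal {mfun X >-> R}) (f : {mfun X >-> R}) (A : set X)
    (M e r s : R) :
  zero_mod_null mu I A -> 0 < M -> (forall x, A x -> `|f x| <= M) ->
  `|r - s| < e / M -> U_ball mu I (r *: f) e (s *: f).
Proof.
move=> zA M0 fM rs; apply/U_ballP; exists A, (`|r - s| * M); split => //.
- by rewrite mulr_ge0// ltW.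
- by rewrite -ltr_pdivlMr.
- move=> x Ax; rewrite -[X in `|X|]/(r * f x - s * f x) -mulrBl normrM.
  by rewrite ler_wpM2l// fM.
Qed.

Theorem theorem3p1 (R : realType) (d : measure_display) (X : measurableType d)
    (X_neq0 : [set: X] !=set0) (mu : {measure set X -> \bar R})
    (I : ring_ideal {mfun X >-> R}) (f : {mfun X >-> R})
    (Lf : Linfty mu I f) :
  continuous (fun r : R => r *: f : U_space mu I).
Proof.
have [A [M [zA M0 fM]]] := Linfty_bound Lf.
move=> r V /nbhs_U_ballP[e e0 eV].
apply/nbhs_ballP; exists (e / M) => /=; first exact: divr_gt0.
by move=> s rs; apply: eV; exact: (U_ball_scale zA M0 fM rs).
Qed.
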